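(* Let $\mathcal{H}$ be a real Hilbert space, let $f:\mathcal{H}\to\overline{\mathbb{R}}$ be proper, convex and lower semicontinuous, and let $h:\mathcal{H}\to\mathbb{R}$ be convex and Fréchet differentiable with $\frac1\beta$-Lipschitz continuous gradient for some $\beta>0$. Let $\gamma:[0,+\infty)\to(0,\beta)$ be Lebesgue measurable, let $x_0\in\mathcal{H}$, and let $x,z:[0,+\infty)\to\mathcal{H}$ be given by $$z(t)=\mathrm{Prox}_{\gamma(t)f}\big(x(t)-\gamma(t)\nabla h(x(t))\big),\qquad 0=\dot x(t)+x(t)-z(t)-\gamma(t)\nabla h(x(t))+\gamma(t)\nabla h(z(t)),\qquad x(0)=x_0.$$ For $t>0$ put $$\Gamma(t):=\int_0^t\gamma(s)\,ds,\qquad \zeta(t):=\frac{1}{\Gamma(t)}\int_0^t\gamma(s)z(s)\,ds.$$ Then $$(f+h)(\zeta(t))\le (f+h)(y)+\frac{\|x(0)-y\|^2}{2\Gamma(t)}$$ for every $y\in\mathcal{H}$ and every $t>0$ such that $\zeta(t)\in\mathrm{dom} f$.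
   Context: $\overline{\mathbb{R}}=\mathbb{R}\cup\{\pm\infty\}$; $\mathrm{dom} f=\{x\in\mathcal{H}: f(x)<+\infty\}$; $f$ is proper if it never takes the value $-\infty$ and $\mathrm{dom} f\ne\emptyset$. For $\eta>0$, $\mathrm{Prox}_{\eta f}(x)=\arg\min_{y\in\mathcal{H}}\{f(y)+\frac{1}{2\eta}\|y-x\|^2\}$ (a unique minimizer). The differential system is understood in the strong global sense: $x$ is locally absolutely continuous on $[0,+\infty)$ (i.e. on each $[0,b]$, $0<b<+\infty$, it is the integral of an integrable function $\dot x$ plus the constant $x(0)$), $z(t)$ is defined by the first equation for all $t$, the second equation holds for almost every $t\in[0,+\infty)$, and $x(0)=x_0$. Such a solution exists and is unique. The integral defining $\zeta(t)$ is the Bochner integral in $\mathcal{H}$. *)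

(* Defs.v *)
From mathcomp Require Import all_boot all_order all_algebra sesquilinear.
From mathcomp Require Import all_classical all_reals all_analysis.

Set Implicit Arguments.
Unset Strict Implicit.
Unset Printing Implicit Defensive.

Import Order.TTheory GRing.Theory Num.Theory.
Import numFieldNormedType.Exports.

Local Open Scope classical_set_scope.
Local Open Scope ring_scope.

Section bochner.
Context {d : measure_display} {T : measurableType d} {R : realType}.
Context (mu : {measure set T -> \bar R}) {V : normedModType R}.
Implicit Types (D : set T) (f : T -> V).

Definition integrable_simple D (s : T -> V) : Prop :=
  finite_set (s @` D) /\
  forall v, measurable (D `&` s @^-1` [set v]) /\
            (v != 0 -> (mu (D `&` s @^-1` [set v]) < +oo)%E).

(* The level set of 0 may have infinite measure; it contributes 0. *)
Definition simple_integral D (s : T -> V) : V :=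
  \sum_(v \in s @` D) fine (mu (D `&` s @^-1` [set v])) *: v.

Definition bochner_approx D f (s_ : nat -> T -> V) : Prop :=
  [/\ forall n, integrable_simple D (s_ n),
      {ae mu, forall t, D t -> s_ n t @[n --> \oo] --> f t} &
      (\int[mu]_(t in D) `|f t - s_ n t|%:E)%E @[n --> \oo] --> 0%E].

Definition bochner_integrable D f : Prop := exists s_ : nat -> T -> V, bochner_approx D f s_.

(* The junk value 0 is only taken when f is not Bochner integrable on D (or
   possibly when V is not complete). *)
Definition bochner_integral D f : V :=
  xget 0 [set v | exists2 s_ : nat -> T -> V, bochner_approx D f s_ &
                              simple_integral D (s_ n) @[n --> \oo] --> v].

End bochner.

(* Lebesgue measure on the sigma-algebra of all Lebesgue measurable sets;
   `lebesgue_measure` only lives on the Borel sets. *)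
Notation Leb R := (@completed_lebesgue_measure R).

Definition lebesgue_measurable_fun {R : realType} (D : set R) (g : R -> R) :=
  measurable_fun (D : set (caratheodory_type ((wlength idfun)^*)%mu)) g.

Section convex_analysis.
Context {R : realType} {H : normedModType R}.
Implicit Types (f : H -> \bar R) (h : H -> R).

Definition edom f : set H := [set x | (f x < +oo)%E].

Definition proper_fun f : Prop := (forall x, f x != -oo%E) /\ edom f !=set0.

(* Only meant for functions that never take the value -oo, for which the
   right-hand side is never of the form +oo - oo. *)
Definition econvex f : Prop :=
  forall (x y : H) (t : R), 0 < t < 1 ->
    (f (t *: x + (1 - t) *: y)%R <= t%:E * f x + (1 - t)%:E * f y)%E.

Definition argmin (F : H -> \bar R) : set H :=
  [set p | forall y, (F p <= F y)%E].

Definition prox (eta : R) f (x : H) : H :=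
  xget 0 (argmin (fun y => (f y + ((2 * eta)^-1 * `|y - x| ^+ 2)%:E)%E)).

(* The vector representing the Frechet differential of h at x, which exists in
   a Hilbert space by the Riesz representation theorem. *)
Definition gradient (dot : {dot H for idfun}) h (x : H) : H :=
  xget 0 [set g | forall v, 'd h x v = dot g v].

End convex_analysis.

Section flow.
Context {R : realType} {H : completeNormedModType R}.

(* x is locally absolutely continuous on [0, +oo[ with a.e. derivative dx. *)
Definition loc_abs_cont_derivative (x dx : R -> H) : Prop :=
  forall b, 0 < b ->
    bochner_integrable (Leb R) `[0, b] dx /\
    forall t, 0 <= t <= b ->
      x t = x 0 + bochner_integral (Leb R) `[0, t] dx.

Definition strong_global_solution (dot : {dot H for idfun})
    (f : H -> \bar R) (h : H -> R) (gamma : R -> R) (x0 : H)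
    (x z : R -> H) : Prop :=
  [/\ forall t, 0 <= t ->
        z t = prox (gamma t) f (x t - gamma t *: gradient dot h (x t)),
      exists2 dx : R -> H, loc_abs_cont_derivative x dx &
        {ae (Leb R), forall t, 0 <= t ->
          0 = dx t + x t - z t - gamma t *: gradient dot h (x t)
              + gamma t *: gradient dot h (z t)} &
      x 0 = x0].

Definition Gamma (gamma : R -> R) (t : R) : R :=
  \int[Leb R]_(s in `[0, t]) gamma s.

Definition zeta (gamma : R -> R) (z : R -> H) (t : R) : H :=
  (Gamma gamma t)^-1 *:
    bochner_integral (Leb R) `[0, t] (fun s => gamma s *: z s).

End flow.

(* Main.v *)
(* Write z for z(s), G for the gradient of h and
   x' = z - x + gamma G(x) - gamma G(z).
   The optimality condition of the proximal step, convexity of h and the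
   Lipschitz bound gamma <= beta give, for almost every s,
     gamma (f(z) + h(z) - f(y) - h(y)) <= - <x', x - y>,
   whose right-hand side is minus the derivative of |x - y|^2 / 2.  What remains
   is Jensen's inequality at the barycenter zeta.  To avoid the measurability of
   f(z(s)), f is minorized by its tangent at p = prox_{l f}(zeta) and h by its
   tangent at zeta: after integration only scalar products with the Bochner
   integral of gamma z are left, and they give
     f(p) + |zeta - p|^2 / l <= M   for all l > 0,
   where M is the claimed bound on f(zeta); let l -> 0 and use lower
   semicontinuity.  The integral of <x', x - y> is handled on a fine subdivision
   of [0, t], with x frozen at the right endpoints, so that the product rule for
   absolutely continuous curves is not needed.  That gamma z is Bochner
   integrable follows from the joint continuity of (g, u) |-> prox_{g f}(u),
   approximating gamma and x by step functions. *)
Require Import Defs.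
From mathcomp Require Import all_boot all_order all_algebra sesquilinear finmap.
From mathcomp Require Import ring lra.
From mathcomp Require Import all_classical all_reals all_analysis.
From mathcomp Require Import measurable_realfun.

Set Implicit Arguments.
Unset Strict Implicit.
Unset Printing Implicit Defensive.

Import Order.TTheory GRing.Theory Num.Theory.
Import numFieldNormedType.Exports.

Local Open Scope classical_set_scope.
Local Open Scope ring_scope.

(** * Convex analysis in a Hilbert space *)

Section hilbert.
Context {R : realType} {H : completeNormedModType R}.
Variables (dot : {dot H for idfun}) (dotE : forall u : H, dot u u = `|u| ^+ 2).
Implicit Types (u v w x y p q : H) (f : H -> \bar R).

(** * Scalar product calculus and the Cauchy-Schwarz inequality *)

Lemma dotC u v : dot u v = dot v u.
Proof. by have := hermC dot u v; rewrite expr0 mul1r. Qed.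

Lemma dotDl u v w : dot (u + v) w = dot u w + dot v w.
Proof. exact: linearDl. Qed.

Lemma dotDr u v w : dot w (u + v) = dot w u + dot w v.
Proof. by rewrite dotC dotDl !(dotC w). Qed.

Lemma dotZl (a : R) u w : dot (a *: u) w = a * dot u w.
Proof. by rewrite linearZl_LR. Qed.

Lemma dotZr (a : R) u w : dot w (a *: u) = a * dot w u.
Proof. by rewrite dotC dotZl dotC. Qed.

Lemma dotNl u w : dot (- u) w = - dot u w.
Proof. by rewrite -scaleN1r dotZl mulN1r. Qed.

Lemma dotNr u w : dot w (- u) = - dot w u.
Proof. by rewrite dotC dotNl dotC. Qed.

Lemma dot0l u : dot 0 u = 0.
Proof. by rewrite -(scale0r 0) dotZl mul0r. Qed.

Lemma dot0r u : dot u 0 = 0.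
Proof. by rewrite dotC dot0l. Qed.

Definition dotL := (dotDl, dotDr, dotNl, dotNr, dotZl, dotZr).

Lemma sqr_normD u v : `|u + v| ^+ 2 = `|u| ^+ 2 + 2 * dot u v + `|v| ^+ 2.
Proof. by rewrite -!dotE !dotL (dotC v u); ring. Qed.

Lemma sqr_normB u v : `|u - v| ^+ 2 = `|u| ^+ 2 - 2 * dot u v + `|v| ^+ 2.
Proof. by rewrite sqr_normD dotNr normrN; ring. Qed.

Lemma dot_le u v : dot u v <= `|u| * `|v|.
Proof.
have [->|v0] := eqVneq v 0; first by rewrite dot0r normr0 mulr0.
(* Expanding this square gives [|u| |v| dot u v <= |u|^2 |v|^2] up to a factor 2; the common factor
   [|u| |v|] is cancelled at the end. *)
have := sqr_ge0 `|(`|v| *: u - `|u| *: v)|.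
rewrite -dotE !dotL !dotE (dotC v u) => h.
have [->|u0] := eqVneq u 0; first by rewrite dot0l normr0 mul0r.
have pu : 0 < `|u| by rewrite normr_gt0.
have pv : 0 < `|v| by rewrite normr_gt0.
rewrite -(ler_pM2l (mulr_gt0 pu pv)); nra.
Qed.

Lemma normr_dot_le u v : `|dot u v| <= `|u| * `|v|.
Proof. by rewrite ler_norml dot_le andbT lerNl -dotNl -(normrN u) dot_le. Qed.

Lemma norm_le_of_dot u v : `|u| ^+ 2 <= dot v u -> `|u| <= `|v|.
Proof.
have [->|u0] := eqVneq u 0; first by rewrite normr0.
have pu : 0 < `|u| by rewrite normr_gt0.
move=> h; rewrite -(ler_pM2r pu) -expr2; exact: le_trans h (dot_le _ _).
Qed.

(** * Convex lower semicontinuous functions and the proximal map *)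

Lemma convex_combE (t : R) x y : t *: x + (1 - t) *: y = y + t *: (x - y).
Proof. by rewrite scalerBl scale1r scalerBr addrCA. Qed.

Lemma econvex_le f x y (a b t : R) : econvex f -> 0 < t < 1 ->
  (f x <= a%:E)%E -> (f y <= b%:E)%E ->
  (f (t *: x + (1 - t) *: y)%R <= (t * a + (1 - t) * b)%:E)%E.
Proof.
move=> cf t01 fx fy; have /andP[t0 t1] := t01.
apply: le_trans (cf _ _ _ t01) _; rewrite (EFinD (t * a)) !EFinM leeD //.
  by rewrite lee_pmul2l// lte_fin.
by rewrite lee_pmul2l// lte_fin subr_gt0.
Qed.

(** The minorant is a downward cone with vertex at [x1]. Near [x1] it comes from lower
    semicontinuity; far away, a value of [f] below the cone would by convexity push [f] below
    [a - 1] at a point of the segment still inside the ball. *)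
Lemma lsc_convex_affine_minorant f x1 (a : R) : econvex f ->
  lower_semicontinuous f -> f x1 = a%:E ->
  exists2 r : R, 0 < r & forall y, ((a - 1 - `|y - x1| / r)%:E <= f y)%E.
Proof.
move=> cf lf fx1.
have [|V /nbhs_ballP[r /= r0 rV] Vf] := lf x1 (a - 1).
  by rewrite fx1 lte_fin; lra.
exists (r / 2); first by lra.
move=> y; have [|yr] := ltP `|y - x1| r.
  move=> yr; apply: le_trans (ltW (Vf y _)).
    by rewrite lee_fin gerBl divr_ge0 //; lra.
  by apply: rV; rewrite -ball_normE /= distrC.
rewrite leNgt; apply/negP => fy.
(* With this [t] the point [x1 + t (y - x1)] is at distance [r / 2] from [x1]. *)
pose d := `|y - x1|; pose t := r / 2 / d.
have d0 : 0 < d by rewrite /d; lra.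
have t01 : 0 < t < 1.
  by rewrite /t divr_gt0//= ?ltr_pdivrMr//; rewrite /d; lra.
have : ((a - 1)%:E < f (x1 + t *: (y - x1))%R)%E.
  apply: Vf; apply: rV; rewrite -ball_normE /= opprD addNKr normrN normrZ.
  rewrite gtr0_norm; last by case/andP: t01.
  rewrite -/d /t divfK ?gt_eqF//; lra.
have := @econvex_le f y x1 _ a t cf t01 (ltW fy).
rewrite fx1 lexx => /(_ isT).
rewrite convex_combE.
move=> h1 h2; have := lt_le_trans h2 h1; rewrite lte_fin.
suff -> : t * (a - 1 - d / (r / 2)) + (1 - t) * a = a - t - 1 by case/andP: t01; lra.
by rewrite /t; field; rewrite !gt_eqF.
Qed.

(** Used twice: for minimizing sequences and for the integrals of approximating simple functions. *)
Lemma cvg_sqr_cauchy (y : nat -> H) (e : nat -> R) :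
  e n @[n --> \oo] --> 0 ->
  (forall n k, `|y n - y k| ^+ 2 <= e n + e k) -> cvgn y.
Proof.
move=> e0 ye; apply/cauchy_cvgP/cauchy_exP => _/posnumP[eps].
have /cvgrPdist_lt/(_ (eps%:num ^+ 2 / 2)) := e0.
rewrite divr_gt0// ?exprn_gt0// => /(_ isT)[N _ Ne].
exists (y N); exists N => // k /= Nk; rewrite -ball_normE /=.
have := Ne N (leqnn N); have := Ne k Nk; rewrite !sub0r !normrN.
move=> /(le_lt_trans (ler_norm _)) ek /(le_lt_trans (ler_norm _)) en.
rewrite -(@ltr_pXn2r _ 2)// ?nnegrE//.
by apply: le_lt_trans (ye N k) _; lra.
Qed.

(** Direct method: the cone minorant makes the infimum finite, the parallelogram law makes a
    minimizing sequence Cauchy, and lower semicontinuity passes to the limit. Values of [f] enter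
    through real upper bounds [b], which keeps the arithmetic in [R]. *)
Lemma quadratic_minimizer f x (c : R) : proper_fun f -> econvex f ->
  lower_semicontinuous f -> 0 < c ->
  exists p a, f p = a%:E /\ forall y b, (f y <= b%:E)%E ->
    a + c * `|p - x| ^+ 2 <= b + c * `|y - x| ^+ 2.
Proof.
move=> [fNy [x1 /= fx1]] cf lf c0.
have fE y : (f y < +oo)%E -> f y = (fine (f y))%:E.
  by move=> fy; rewrite fineK// fin_numE fNy lt_eqF.
have [r r0 fr] := lsc_convex_affine_minorant cf lf (fE _ fx1).
set a1 := fine (f x1) in fr.
pose S := [set v | exists y b, (f y <= b%:E)%E /\ v = b + c * `|y - x| ^+ 2].
have S0 : S !=set0.
  by exists (a1 + c * `|x1 - x| ^+ 2), x1, a1; rewrite -fE.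
have lbS : has_lbound S.
  (* The last term is what remains after completing the square in [c d^2 - d / r], where [d] is the
     distance from [y] to [x]. *)
  exists (a1 - 1 - `|x - x1| / r - (4 * c * r ^+ 2)^-1) => _ [y [b [fyb ->]]].
  have := le_trans (fr y) fyb; rewrite lee_fin => ab.
  have : `|y - x1| / r <= `|y - x| / r + `|x - x1| / r.
    rewrite -mulrDl ler_pM2r ?invr_gt0//.
    by rewrite (le_trans _ (ler_normD _ _))// addrA subrK.
  have : 0 <= c * (`|y - x| - (2 * c * r)^-1) ^+ 2.
    by rewrite mulr_ge0 ?sqr_ge0// ltW.
  have -> : c * (`|y - x| - (2 * c * r)^-1) ^+ 2 =
      c * `|y - x| ^+ 2 - `|y - x| / r + (4 * c * r ^+ 2)^-1.
    by field; rewrite !gt_eqF.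
  lra.
pose m := inf S.
have mS y b : (f y <= b%:E)%E -> m <= b + c * `|y - x| ^+ 2.
  by move=> fyb; apply: (ge_inf lbS); exists y, b.
have /choice[y_ /choice[b_ yb]] : forall n : nat, exists y b,
    (f y <= b%:E)%E /\ b + c * `|y - x| ^+ 2 < m + n.+1%:R^-1.
  move=> n; have [||_ [y [b [fyb ->]]] h] := @inf_adherent _ S n.+1%:R^-1.
  - by rewrite invr_gt0.
  - by split.
  - by exists y, b.
have [p yp] : exists p, y_ n @[n --> \oo] --> p.
  (* The functional is at least [m] at the midpoint of [y_ n] and [y_ k]; the parallelogram law
     turns this into a bound on their distance. *)
  apply/cvg_ex; apply: (@cvg_sqr_cauchy _ (fun n => 2 / c * n.+1%:R^-1)).
    by rewrite -[X in _ --> X](mulr0 (2 / c)); apply: cvgMr; exact: cvg_harmonic.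
  move=> n k; have [fn hn] := yb n; have [fk hk] := yb k.
  have /mS : (f (2^-1 *: y_ n + (1 - 2^-1) *: y_ k)%R <=
      (2^-1 * b_ n + (1 - 2^-1) * b_ k)%:E)%E by apply: econvex_le => //; lra.
  have -> : 2^-1 *: y_ n + (1 - 2^-1) *: y_ k - x =
      2^-1 *: ((y_ n - x) + (y_ k - x)).
    rewrite (_ : 1 - 2^-1 = 2^-1); last by field.
    rewrite !scalerDr addrACA -scalerDl (_ : 2^-1 + 2^-1 = 1) ?scale1r//.
    by field.
  rewrite normrZ exprMn ger0_norm ?invr_ge0//.
  have -> : y_ n - y_ k = (y_ n - x) - (y_ k - x) by rewrite opprB addrA subrK.
  move: hn hk; move: (y_ n - x) (y_ k - x) => u v hn hk.
  rewrite sqr_normB sqr_normD -mulrDr [2 / c * _]mulrAC ler_pdivlMr//.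
  move: hn hk; set dn := n.+1%:R^-1; set dk := k.+1%:R^-1.
  move: (`|u| ^+ 2) (`|v| ^+ 2) (dot u v) dn dk => U V D dn dk hn hk h.
  have -> : (U - 2 * D + V) * c = 2 * (c * U) + 2 * (c * V) -
     4 * (c * (2^-1 ^+ 2 * (U + 2 * D + V))) by field.
  lra.
(* Finiteness of [f p] is not yet known, so the bound is proved for every real [a] below [f p];
   taking [a = m + 1] then excludes [+oo]. *)
have key (a : R) : (a%:E < f p)%E -> a + c * `|p - x| ^+ 2 <= m.
  move=> /lf[V pV Vf].
  have -> : m = limn (fun n => m + n.+1%:R^-1).
    apply/esym/cvg_lim => //; rewrite -[X in _ --> X]addr0.
    by apply: cvgD; [exact: cvg_cst|exact: cvg_harmonic].
  have cn : (fun n => a + c * `|y_ n - x| ^+ 2) @ \oo --> a + c * `|p - x| ^+ 2.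
    apply: cvgD; first exact: cvg_cst.
    apply: cvgMr; rewrite expr2; apply: cvgM; apply: cvg_norm;
      by apply: cvgB => //; exact: cvg_cst.
  rewrite -(cvg_lim _ cn)//; apply: ler_lim.
  - by apply/cvg_ex; exists (a + c * `|p - x| ^+ 2).
  - by apply: is_cvgD; [exact: is_cvg_cst|apply/cvg_ex; exists 0; exact: cvg_harmonic].
  near=> n; have [fn hn] := yb n; apply: le_trans (ltW hn).
  rewrite lerD2r -lee_fin; apply: le_trans fn; apply/ltW/Vf.
  by near: n; exact: yp.
have fpy : (f p < +oo)%E.
  rewrite ltey; apply/eqP => fp.
  have := key (m + 1); rewrite fp ltry => /(_ isT); rewrite leNgt => /negP; apply.
  by rewrite ltr_wpDr ?mulr_ge0 ?sqr_ge0 ?ltrDl// ltW.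
exists p, (fine (f p)); split; first exact: fE.
move=> y b /mS; apply: le_trans => //.
apply/ler_addgt0Pr => e e0; rewrite -lerBlDr addrAC.
by apply: key; rewrite [X in (_ < X)%E]fE// lte_fin ltrBlDr ltrDl.
Unshelve. all: by end_near.
Qed.

(** This is the inclusion of [x - p] in [eta] times the subdifferential of [f] at
    [p = prox eta f x]: compare [p] with [t y + (1 - t) p], divide by [t] and let [t] tend to 0. *)
Lemma prox_spec f x (eta : R) : proper_fun f -> econvex f ->
  lower_semicontinuous f -> 0 < eta ->
  exists a, f (prox eta f x) = a%:E /\ forall y b, (f y <= b%:E)%E ->
    eta * (a - b) <= dot (x - prox eta f x) (prox eta f x - y).
Proof.
move=> fp cf lf eta0.
have c0 : 0 < (2 * eta)^-1 by rewrite invr_gt0 mulr_gt0.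
have [p0 [a0 [fp0 h0]]] := quadratic_minimizer x fp cf lf c0.
have fE y : (f y < +oo)%E -> f y = (fine (f y))%:E.
  by move=> fy; rewrite fineK// fin_numE (fp.1) lt_eqF.
have : argmin (fun y => f y + ((2 * eta)^-1 * `|y - x| ^+ 2)%:E)%E (prox eta f x).
  apply: (@xgetPex _ 0); exists p0 => y.
  have [fy|] := ltP (f y) +oo%E; last first.
    by rewrite leye_eq => /eqP ->; rewrite addye// leey.
  by rewrite fp0 (fE _ fy) -!EFinD lee_fin; apply: h0; rewrite -fE.
set p := prox eta f x => pmin.
have fpy : (f p < +oo)%E.
  have := pmin p0; rewrite fp0; by case: (f p) (fp.1 p) => // r _ _; rewrite ltry.
have hp y b : (f y <= b%:E)%E ->
    fine (f p) + (2 * eta)^-1 * `|p - x| ^+ 2 <= b + (2 * eta)^-1 * `|y - x| ^+ 2.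
  move=> fy; rewrite -lee_fin !EFinD -fE//; apply: le_trans (pmin y) _.
  by rewrite leeD2r.
exists (fine (f p)); split; first exact: fE.
move=> y b fy; set a := fine (f p) in hp *.
suff h (t : R) : 0 < t < 1 ->
    eta * (a - b) <= dot (x - p) (p - y) + t / 2 * `|y - p| ^+ 2.
  apply/ler_addgt0Pr => e e0; set d := `|y - p| ^+ 2 in h.
  have d0 : 0 <= d by exact: sqr_ge0.
  (* Small enough that [t / 2 * d <= e]; the [+ 1] covers [d = 0]. *)
  pose t := Num.min (2^-1) (e / (d + 1)).
  have d1 : 0 < d + 1 by lra.
  have t0 : 0 < t by rewrite lt_min divr_gt0// andbT; lra.
  have t1 : t <= 2^-1 by rewrite ge_min lexx.
  have te : t <= e / (d + 1) by rewrite ge_min lexx orbT.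
  apply: (le_trans (h t _)); first lra.
  rewrite lerD2l; rewrite ler_pdivlMr// in te; nra.
move=> /[dup] t01 /andP[t0 t1].
have /hp : (f (t *: y + (1 - t) *: p)%R <= (t * b + (1 - t) * a)%:E)%E.
  by apply: econvex_le => //; rewrite /a -fE.
have -> : t *: y + (1 - t) *: p - x = (p - x) + t *: (y - p).
  by rewrite convex_combE addrAC.
rewrite (sqr_normD (p - x)) normrZ exprMn dotZr (ger0_norm (ltW t0)).
have -> : dot (x - p) (p - y) = dot (p - x) (y - p).
  by rewrite -(opprB p) -(opprB y) dotNl dotNr opprK.
set D := dot _ _; set d := `|y - p| ^+ 2; set q := `|p - x| ^+ 2.
move=> hh; rewrite -(ler_pM2l t0).
have : eta * (a + (2 * eta)^-1 * q) <= 
   eta * (t * b + (1 - t) * a + (2 * eta)^-1 * (q + 2 * (t * D) + t ^+ 2 * d)).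
  by rewrite ler_pM2l.
have -> : eta * (a + (2 * eta)^-1 * q) = eta * a + q / 2 by field; rewrite gt_eqF.
have -> : eta * (t * b + (1 - t) * a + (2 * eta)^-1 * (q + 2 * (t * D) + t ^+ 2 * d))
  = eta * (t * b + (1 - t) * a) + (q + 2 * (t * D) + t ^+ 2 * d) / 2.
  by field; rewrite gt_eqF.
by lra.
Qed.

(** Adding the two optimality inequalities, the second one scaled by [g / m], cancels the values of
    [f]. The bound yields nonexpansiveness for [g = m] and joint continuity in the step size and the
    point. *)
Lemma prox_dist_le f (g m : R) u v : proper_fun f -> econvex f ->
  lower_semicontinuous f -> 0 < g -> 0 < m ->
  `|prox g f u - prox m f v| <= `|u - v| + `|1 - g / m| * `|v - prox m f v|.
Proof.
move=> fp cf lf g0 m0.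
have [a [fpa ha]] := prox_spec u fp cf lf g0.
have [b [fpb hb]] := prox_spec v fp cf lf m0.
move: fpa fpb ha hb; set p := prox g f u; set q := prox m f v => fpa fpb ha hb.
have {}ha := ha q b; rewrite fpb lexx in ha; have {}ha := ha isT.
have {}hb := hb p a; rewrite fpa lexx in hb; have {}hb := hb isT.
rewrite -normrZ; apply: le_trans (ler_normD _ _); apply: norm_le_of_dot.
have -> : u - v + (1 - g / m) *: (v - q) = (u - p) - (g / m) *: (v - q) + (p - q).
  by rewrite scalerBl scale1r [RHS]addrAC addrA !subrKA.
rewrite [dot _ _]dotDl dotE lerDr dotDl dotNl dotZl subr_ge0 -(opprB q p) dotNr.
rewrite -(opprB q p) dotNr in ha.
have : g / m * (m * (b - a)) <= g / m * dot (v - q) (q - p).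
  by rewrite ler_pM2l// divr_gt0.
by rewrite mulrA divfK ?gt_eqF//; lra.
Qed.

(* The representing vector is the minimizer of |y|^2 / 2 - phi y. *)
Lemma riesz_representation (phi : {linear H -> R^o}) : continuous phi ->
  exists g, forall v, phi v = dot g v.
Proof.
move=> cphi; pose f (y : H) := (- phi y : R)%:E.
have fp : proper_fun f.
  by split=> //; exists 0; rewrite /edom /= ltry.
have cf : econvex f.
  move=> x y t _; rewrite /f -!EFinM -EFinD lee_fin linearD !linearZ /=.
  by rewrite !mulrN -opprD.
have lf : lower_semicontinuous f.
  move=> x a; rewrite lte_fin => ax.
  exists [set y | a < - phi y] => [|y]; last by rewrite lte_fin.
  have : (fun y => - phi y) @ x --> - phi x by apply: cvgN; exact: cphi.
  by move/cvgr_gt; apply.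
have [a [fpa ha]] := prox_spec 0 fp cf lf ltr01.
move: fpa ha; set p := prox _ _ _ => -[fpa] ha; exists p => v.
have h w : phi w <= dot p w.
  have := ha (p + w) (- phi (p + w)) (lexx _).
  by rewrite -fpa linearD sub0r dotNl (opprD p) addNKr dotNr opprK mul1r /=; lra.
by apply/le_anti; rewrite h/= -lerN2 -linearN -dotNr h.
Qed.

Lemma gradientE (h : H -> R) x : differentiable h x ->
  forall v, 'd h x v = dot (gradient dot h x) v.
Proof.
move=> dh; rewrite /gradient.
case: xgetP => [g -> //|] /=.
have [g gE] := riesz_representation (diff_continuous dh).
by move=> /(_ g) /(_ gE).
Qed.

(** By convexity the right difference quotients along [y - x] are at most [h y - h x], hence so is
    their limit. *)
Lemma convex_gradient_le (h : H -> R) x y :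
  convex_function [set: convex_lmodType H] h -> differentiable h x ->
  h x + dot (gradient dot h x) (y - x) <= h y.
Proof.
move=> ch dh; rewrite -gradientE// -deriveE// -lerBrDl.
have /cvg_dnbhs_at_right := @diff_derivable _ _ _ _ _ (y - x) dh.
move=> /cvgr_to_le; apply; near=> t.
have t0 : 0 < t by near: t; exact: nbhs_right_gt.
have t1 : t < 1 by near: t; apply: nbhs_right_lt.
have := ch (Itv01 (ltW t0) (ltW t1)) y x; rewrite !in_setT => /(_ isT isT).
rewrite convRE /= /unstable.onem.
have -> : conv (Itv01 (ltW t0) (ltW t1)) (y : convex_lmodType H) x =
    t *: (y - x) + x by rewrite [RHS]addrC -convex_combE.
rewrite -[_ *: (h _ - _)]/(_ * _) [_^-1 * _]mulrC ler_pdivrMr//; lra.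
Unshelve. all: by end_near.
Qed.

(** If [f z > M], then [f > M] on a ball around [z], and [prox l f z], where [f] is at most [M],
    stays outside it. For small [l] the quadratic term then exceeds whatever the cone minorant
    allows [f] to lose. *)
Lemma le_of_prox_le f z (M : R) : proper_fun f -> econvex f ->
  lower_semicontinuous f ->
  (forall l a, 0 < l -> f (prox l f z) = a%:E ->
     a + `|z - prox l f z| ^+ 2 / l <= M) ->
  (f z <= M%:E)%E.
Proof.
move=> fp cf lf h; rewrite leNgt; apply/negP => /lf[V /nbhs_ballP[r /= r0 rV] Vf].
have [x1 fx1] := fp.2.
have [|s s0 fs] := @lsc_convex_affine_minorant f x1 (fine (f x1)) cf lf.
  by rewrite fineK// fin_numE fp.1 lt_eqF.
set a1 := fine (f x1) in fs.
pose K := `|M - a1 + 1 + `|z - x1| / s|.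
(* Here [c = 1 / l]. Since the distance [d] is at least [r], the three terms times [d^2] dominate
   the constants [K], dominate the slope term [d / s], and make the inequality strict. *)
pose c := K / r ^+ 2 + (s * r)^-1 + 1.
have c0 : 0 < c.
  have rs : 0 < (s * r)^-1 by rewrite invr_gt0 mulr_gt0.
  have K0 : 0 <= K / r ^+ 2 by rewrite divr_ge0 ?sqr_ge0 ?normr_ge0.
  by rewrite /c; lra.
have l0 : 0 < c^-1 by rewrite invr_gt0.
have [a [fpa _]] := prox_spec z fp cf lf l0.
have hfp := h _ a l0 fpa; move: hfp fpa.
set p := prox _ f z; rewrite invrK => hp fpa.
pose d := `|z - p|.
have rd : r <= d.
  rewrite leNgt; apply/negP => dr.
  have /rV/Vf : ball z r p by rewrite -ball_normE.
  rewrite fpa lte_fin ltNge => /negP; apply.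
  by apply: le_trans hp; rewrite lerDl mulr_ge0 ?sqr_ge0// ltW.
have := fs p; rewrite fpa lee_fin => ha.
have : `|p - x1| / s <= d / s + `|z - x1| / s.
  rewrite -mulrDl ler_pM2r ?invr_gt0// /d (distrC z p).
  by rewrite (le_trans _ (ler_normD _ _))// addrA subrK.
have : M - a1 + 1 + `|z - x1| / s <= K by exact: ler_norm.
have : K <= d ^+ 2 * (K / r ^+ 2).
  rewrite mulrCA ler_peMr// ?normr_ge0// ler_pdivlMr ?exprn_gt0// mul1r.
  by rewrite ler_pXn2r ?nnegrE// ltW// (lt_le_trans r0).
have : d / s <= d ^+ 2 * (s * r)^-1.
  rewrite (_ : d ^+ 2 * _ = d / s * (d / r)); last by field; rewrite !gt_eqF.
  rewrite ler_peMr//.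
    by rewrite divr_ge0// ltW// (lt_le_trans r0).
  by rewrite ler_pdivlMr// mul1r.
have : 0 < d ^+ 2 by rewrite exprn_gt0// (lt_le_trans r0).
rewrite -/d /c in hp; lra.
Qed.

End hilbert.

(** * The Bochner integral *)

Section bochner_integral_theory.
Context {d : measure_display} {T : measurableType d} {R : realType}.
Context (mu : {measure set T -> \bar R}) {H : completeNormedModType R}.
Variables (dot : {dot H for idfun}) (dotE : forall u : H, dot u u = `|u| ^+ 2).
Implicit Types (D : set T) (f s : T -> H).

(** The pair of functions takes finitely many values, so any preimage is a finite union of
    intersections of level sets, whatever [phi] is. *)
Lemma measurable_fun_simple2 D s s' (phi : H -> H -> R) :
  integrable_simple mu D s -> integrable_simple mu D s' ->
  measurable_fun D (fun t => phi (s t) (s' t)).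
Proof.
move=> [fs ms] [fs' ms'] mD B mB.
pose I := [set p | [/\ (s @` D) p.1, (s' @` D) p.2 & B (phi p.1 p.2)]].
have -> : D `&` (fun t => phi (s t) (s' t)) @^-1` B =
    \bigcup_(p in I) ((D `&` s @^-1` [set p.1]) `&` (D `&` s' @^-1` [set p.2])).
  apply/seteqP; split=> [t [Dt Bt]|t [[u v] [_ _ /= Bt] /= [[Dt su] [_ sv]]]].
  by exists (s t, s' t) => //; split => //; exists t.
  by split; rewrite //= su sv.
apply: fin_bigcup_measurable => [|p _].
  by apply: (sub_finite_set _ (finite_setX fs fs')) => p [].
by apply: measurableI; [exact: (ms _).1|exact: (ms' _).1].
Qed.

(** The condition [phi 0 = 0] silences the level set of 0, whose measure may be infinite. *)
Lemma integrable_simple_comp D s (phi : H -> R) : measurable D ->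
  integrable_simple mu D s -> phi 0 = 0 ->
  mu.-integrable D (EFin \o (phi \o s)) /\
  \int[mu]_(t in D) phi (s t) =
    \sum_(v <- fset_set (s @` D)) fine (mu (D `&` s @^-1` [set v])) * phi v.
Proof.
move=> mD [fs ms] phi0.
pose A v := D `&` s @^-1` [set v].
have mA v : measurable (A v) by exact: (ms v).1.
pose g v t := phi v * \1_(A v) t.
have gP v : mu.-integrable D (EFin \o g v) /\
    \int[mu]_(t in D) g v t = fine (mu (A v)) * phi v.
  have [v0|v0] := eqVneq v 0.
    have g0 : g v = cst 0 by apply/funext => t; rewrite /g v0 phi0 mul0r.
    rewrite g0; split; first exact: integrable0.
    by rewrite v0 phi0 mulr0 /Rintegral integral0.
  have muA := (ms v).2 v0.
  have i1 : mu.-integrable D (EFin \o \1_(A v)).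
    apply/integrableP; split.
      by apply/measurable_EFinP; exact: measurable_indic.
    under eq_integral do rewrite /= ger0_norm//.
    by rewrite integral_indic// (_ : A v `&` D = A v)//; apply: setIidl => t [].
  split; first exact: (integrableZl mD (phi v) i1).
  rewrite RintegralZl// mulrC; congr (_ * _).
  rewrite /Rintegral integral_indic// (_ : A v `&` D = A v)//.
  by apply: setIidl => t [].
have sumP (r : seq H) : mu.-integrable D (EFin \o (fun t => \sum_(v <- r) g v t)) /\
    \int[mu]_(t in D) (\sum_(v <- r) g v t) = \sum_(v <- r) fine (mu (A v)) * phi v.
  elim: r => [|v r [ih1 ih2]].
    rewrite big_nil (_ : (fun _ => _) = cst 0); last first.
      by apply/funext => t; rewrite big_nil.
    by split; [exact: integrable0|rewrite /Rintegral integral0].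
  rewrite big_cons (_ : (fun _ => _) = (fun t => g v t + \sum_(v <- r) g v t)).
    split; first exact: (integrableD mD (gP v).1 ih1).
    by rewrite RintegralD// ?ih2 ?(gP v).2//; exact: (gP v).1.
  by apply/funext => t; rewrite big_cons.
have E t : D t -> phi (s t) = \sum_(v <- fset_set (s @` D)) g v t.
  move=> Dt; rewrite (bigD1_seq (s t)) ?fset_uniq//=; last first.
    by rewrite in_fset_set// inE; exists t.
  rewrite big1 ?addr0 => [|v vs]; rewrite /g indicE.
    by rewrite mem_set ?mulr1.
  by rewrite memNset ?mulr0// => -[_] /esym/eqP; exact/negP.
have [i1 i2] := sumP (fset_set (s @` D)); split.
  by apply: eq_integrable i1 => // t; rewrite inE => Dt /=; rewrite E.
by rewrite -i2; apply: eq_Rintegral => t; rewrite inE => /E.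
Qed.

Lemma dot_simple_integral D s w : measurable D -> integrable_simple mu D s ->
  dot w (simple_integral mu D s) = \int[mu]_(t in D) dot w (s t).
Proof.
move=> mD sD; have [_ ->] := integrable_simple_comp mD sD (dot0r dot w).
rewrite /simple_integral fsbig_finite; last exact: sD.1.
rewrite (big_morph (dot w) (fun u v => dotDr dot u v w) (dot0r dot w)).
by apply: eq_bigr => v _; rewrite dotZr.
Qed.

Lemma continuous_dotl w : continuous (dot^~ w : H -> R).
Proof.
move=> u; apply/cvgrPdist_lt => _/posnumP[e].
have ew : 0 < e%:num / (`|w| + 1) by rewrite divr_gt0// ltr_wpDl.
have := @cvg_id _ (nbhs u); move=> /cvgrPdist_lt/(_ _ ew); apply: filterS => v uv.
rewrite -[X in X < _]/(`|dot u w - dot v w|) -dotNl -dotDl.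
apply: le_lt_trans (normr_dot_le dotE _ _) _.
rewrite ltr_pdivlMr ?ltr_wpDl// in uv; apply: le_lt_trans uv.
by rewrite ler_wpM2l// lerDl.
Qed.

(** * Bochner integrals over a complete measure, tested against vectors *)

Section approximations.
Hypothesis mu_complete : measure_is_complete mu.

(** Off a null set [N] the function is a pointwise limit of measurable ones; completeness of [mu]
    absorbs [N]. *)
Lemma measurable_bochner_approx D f (s_ : nat -> T -> H) s (phi : H -> H -> R) :
  measurable D -> bochner_approx mu D f s_ -> integrable_simple mu D s ->
  (forall v, continuous (phi^~ v)) -> measurable_fun D (fun t => phi (f t) (s t)).
Proof.
move=> mD [s_D [N [mN N0 sN]] _] sD cphi.
have mg : measurable_fun D (fun t => phi (f t) (s t) * \1_(~` N) t).
  apply: (@measurable_realfun.measurable_fun_cvg _ _ _ _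
    (fun n t => phi (s_ n t) (s t) * \1_(~` N) t)).
    move=> n; apply: measurable_funM; first exact: measurable_fun_simple2.
    by apply: measurable_indic; exact: measurableC.
  move=> t Dt; have [Nt|Nt] := pselect (N t).
    rewrite indicE memNset ?mulr0; last by move=> /(_ Nt).
    by under eq_fun do rewrite mulr0; exact: cvg_cst.
  apply: cvgMl; apply: (cvg_comp (s_ ^~ t) (phi^~ (s t)) _ (cphi (s t) (f t))).
  by apply: contrapT => h; apply: Nt; apply: sN => /(_ Dt).
apply/measurable_EFinP; apply: (ae_measurable_fun mu_complete); last first.
  by apply/measurable_EFinP; exact: mg.
exists N; split => // t /= h; apply: contrapT => Nt; apply: h => _.
by rewrite indicE mem_set// mulr1.
Qed.

Lemma fin_num_lt_pinfty (x : \bar R) : x \is a fin_num -> (x < +oo)%E.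
Proof. by rewrite ltey_eq => ->. Qed.

(** The finiteness of the error integral is assumed at the index [n], because convergence to 0
    ensures it only for large indices. *)
Lemma bochner_approx_norm_integrable D f (s_ : nat -> T -> H) n :
  measurable D -> bochner_approx mu D f s_ ->
  (\int[mu]_(t in D) `|f t - s_ n t|%:E < +oo)%E ->
  mu.-integrable D (EFin \o (fun t => `|f t - s_ n t|)) /\
  mu.-integrable D (EFin \o (fun t => `|f t|)).
Proof.
move=> mD fs fin; have [sD _ _] := fs.
have cn v : continuous (fun u : H => `|u - v|).
  by move=> u; apply: cvg_norm; apply: cvgB; [exact: cvg_id|exact: cvg_cst].
have i1 : mu.-integrable D (EFin \o (fun t => `|f t - s_ n t|)).
  apply/integrableP; split.
    by apply/measurable_EFinP; exact: (measurable_bochner_approx mD fs (sD n) cn).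
  by under eq_integral do rewrite /= normr_id.
split=> //.
have [i2 _] := integrable_simple_comp mD (sD n) (@normr0 _ H).
apply: (le_integrable mD _ _ (integrableD mD i1 i2)).
  apply/measurable_EFinP.
  apply: (measurable_bochner_approx mD fs (sD n) (phi := fun u _ => `|u|)) => _.
  exact: norm_continuous.
move=> t Dt; rewrite /= lee_fin normr_id ger0_norm ?addr_ge0//.
by rewrite (le_trans _ (ler_normD _ _))// subrK.
Qed.

Lemma dot_bochner_approx D f (s_ : nat -> T -> H) n w :
  measurable D -> bochner_approx mu D f s_ ->
  (\int[mu]_(t in D) `|f t - s_ n t|%:E < +oo)%E ->
  mu.-integrable D (EFin \o (fun t => dot w (f t))) /\
  `|dot w (simple_integral mu D (s_ n)) - \int[mu]_(t in D) dot w (f t)| <=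
    `|w| * \int[mu]_(t in D) `|f t - s_ n t|.
Proof.
move=> mD fs fin; have [sD _ _] := fs.
have [i1 i2] := bochner_approx_norm_integrable mD fs fin.
have i3 : mu.-integrable D (EFin \o (fun t => dot w (f t))).
  apply: (le_integrable mD _ _ (integrableZl mD `|w| i2)).
    apply/measurable_EFinP.
    apply: (measurable_bochner_approx mD fs (sD n) (phi := fun u _ => dot w u)).
    move=> _; rewrite (_ : (fun u => _) = dot^~ w); last first.
      by apply/funext => u; rewrite dotC.
    exact: continuous_dotl.
  move=> t Dt; rewrite /= lee_fin [leRHS]ger0_norm ?mulr_ge0//.
  exact: normr_dot_le.
have [i4 _] := integrable_simple_comp mD (sD n) (dot0r dot w).
split=> //; rewrite dot_simple_integral// -RintegralB//.
apply: le_trans (le_normr_Rintegral mD (integrableB mD i4 i3)) _.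
rewrite -RintegralZl//; apply: le_Rintegral => //.
- exact: (integrable_abse (integrableB mD i4 i3)).
- exact: (integrableZl mD `|w| i1).
- move=> t Dt; rewrite -dotNr -dotDr distrC; exact: normr_dot_le.
Qed.

(** The difference of two simple integrals is tested against itself, which bounds its norm by the
    sum of the two approximation errors. *)
Lemma bochner_approx_cvg D f (s_ : nat -> T -> H) :
  measurable D -> bochner_approx mu D f s_ ->
  exists v : H, simple_integral mu D (s_ n) @[n --> \oo] --> v.
Proof.
move=> mD fs; have [sD _ /fine_cvgP[[N _ fN] f0]] := fs.
have fin n : (\int[mu]_(t in D) `|f t - s_ (n + N)%N t|%:E < +oo)%E.
  by rewrite ltey_eq fN//= leq_addl.
suff /cvg_ex[v hv] : cvgn (fun n => simple_integral mu D (s_ (n + N)%N)).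
  by exists v; rewrite -(cvg_shiftn N).
pose e n := \int[mu]_(t in D) `|f t - s_ (n + N)%N t|.
have e0 : e n @[n --> \oo] --> 0 by rewrite -(cvg_shiftn N) in f0.
have e_ge0 n : 0 <= e n by apply: Rintegral_ge0.
(* Uses [(e n + e k)^2 <= 2 e n^2 + 2 e k^2]. *)
apply: (@cvg_sqr_cauchy _ _ _ (fun n => 2 * e n ^+ 2)).
  rewrite -[X in _ --> X](mulr0 2); apply: cvgMr.
  by rewrite -[X in _ --> X](mulr0 0); apply: cvgM.
move=> n k; set u := simple_integral _ _ _; set v := simple_integral _ _ _.
have [_ h1] := dot_bochner_approx (u - v) mD fs (fin n).
have [_ h2] := dot_bochner_approx (u - v) mD fs (fin k).
have : `|u - v| ^+ 2 <= `|u - v| * (e n + e k).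
  rewrite -dotE {2}/GRing.add dotDr dotNr mulrDr.
  move: h1 h2; rewrite -/(e n) -/(e k) -/u -/v !ler_norml => /andP[? ?] /andP[? ?].
  lra.
have : 0 <= (e n - e k) ^+ 2 by rewrite sqr_ge0.
have := e_ge0 n; have := e_ge0 k; have := normr_ge0 (u - v).
set a := `|u - v| => ? ? ? ? ?.
have [->|a0] := eqVneq a 0; first nra.
have : a <= e n + e k by rewrite -(@ler_pM2l _ a) -?expr2// lt_neqAle eq_sym a0.
nra.
Qed.

(** [bochner_integral] selects some limit along some approximating sequence. Every such limit has
    the same scalar products, and one exists, so neither the choice nor the default value
    matters. *)
Lemma dot_bochner_integral D f w : measurable D -> bochner_integrable mu D f ->
  mu.-integrable D (EFin \o (fun t => dot w (f t))) /\
  dot w (bochner_integral mu D f) = \int[mu]_(t in D) dot w (f t).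
Proof.
move=> mD [s0 fs0]; have [v0 hv0] := bochner_approx_cvg mD fs0.
rewrite /bochner_integral; case: xgetP => [v _ [s_ fs sv]|]; last first.
  by move=> /(_ v0) []; exists s0.
have [sD _ /fine_cvgP[fN f0]] := fs.
have [N _ hN] := fN; split.
  by have [] := dot_bochner_approx w mD fs (fin_num_lt_pinfty (hN N (leqnn N))).
have c1 : dot w (simple_integral mu D (s_ n)) @[n --> \oo] --> dot w v.
  rewrite dotC; under eq_fun do rewrite dotC.
  exact: (cvg_comp _ (dot^~ w) sv (@continuous_dotl w v)).
have c2 : dot w (simple_integral mu D (s_ n)) @[n --> \oo] -->
    \int[mu]_(t in D) dot w (f t).
  apply/subr_cvg0; apply: norm_cvg0.
  apply: (squeeze_cvgr (f := cst 0)
    (h := fun n => `|w| * \int[mu]_(t in D) `|f t - s_ n t|)).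
  - exists N => // n /= Nn; rewrite normr_ge0/=.
    by have [] := dot_bochner_approx w mD fs (fin_num_lt_pinfty (hN n Nn)).
  - exact: cvg_cst.
  - by rewrite -[X in _ --> X](mulr0 `|w|); apply: cvgMr; exact: f0.
by apply: (cvg_unique _ c1 c2).
Qed.

Lemma bochner_norm_integrable D f : measurable D -> bochner_integrable mu D f ->
  mu.-integrable D (EFin \o (fun t => `|f t|)).
Proof.
move=> mD [s_ fs]; have [sD _ /fine_cvgP[[N _ hN] _]] := fs.
by have [] := bochner_approx_norm_integrable mD fs (fin_num_lt_pinfty (hN N (leqnn N))).
Qed.

End approximations.

(** Dominated convergence, with the constant [C + C] as dominating function on a set of finite
    measure. *)
Lemma bochner_integrable_bounded_limit D f (s_ : nat -> T -> H) (C : R) :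
  measurable D -> (mu D < +oo)%E -> (forall n, integrable_simple mu D (s_ n)) ->
  (forall t, D t -> s_ n t @[n --> \oo] --> f t) ->
  (forall n t, D t -> `|s_ n t| <= C) -> bochner_integrable mu D f.
Proof.
move=> mD muD sD sf sC; exists s_; split => //; first exact: aeW.
have cn n t : D t -> `|s_ m t - s_ n t| @[m --> \oo] --> `|f t - s_ n t|.
  by move=> Dt; apply: cvg_norm; apply: cvgB; [exact: sf|exact: cvg_cst].
have fC n t : D t -> `|f t - s_ n t| <= C + C.
  move=> Dt; apply: (cvgr_to_le (cn n t Dt)); near=> m.
  by apply: le_trans (ler_normB _ _) _; rewrite lerD// sC.
rewrite -(@integral0 _ _ _ mu D).
apply: (@dominated_cvg _ _ _ _ _ mD _ _ (fun=> (C + C)%:E)).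
- move=> n; apply/measurable_EFinP.
  apply: (measurable_realfun.measurable_fun_cvg (h := fun m t => `|s_ m t - s_ n t|)).
    by move=> m; exact: (measurable_fun_simple2 (fun u v => `|u - v|)).
  by move=> t; exact: cn.
- move=> t Dt; apply: cvg_EFin; first exact: nearW.
  rewrite /comp /= -(normr0 H) -(subrr (f t)); apply: cvg_norm.
  by apply: cvgB; [exact: cvg_cst|exact: sf].
- by [].
- apply/integrableP; split; first exact: measurable_cst.
  by rewrite integral_cst//= lte_mul_pinfty.
- by move=> n t Dt; rewrite /= lee_fin normr_id fC.
Unshelve. all: by end_near.
Qed.

Lemma integrable_simple_fin (I : finType) D (c : T -> I) (G : I -> H) :
  (mu D < +oo)%E -> measurable D ->
  (forall i, measurable (D `&` c @^-1` [set i])) ->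
  integrable_simple mu D (G \o c).
Proof.
move=> muD mD mc; split.
  apply: (@sub_finite_set _ _ (G @` setT)); last exact: finite_image.
  by move=> _ [t _ <-]; exists (c t).
have mG v : measurable (D `&` (G \o c) @^-1` [set v]).
  rewrite (_ : _ `&` _ = \bigcup_(i in [set i | G i = v]) (D `&` c @^-1` [set i])).
    by apply: fin_bigcup_measurable => // i _.
  apply/seteqP; split=> [t [Dt /= Gt]|t [i /= Gi [Dt /= ct]]].
    by exists (c t).
  by split => //=; rewrite ct.
move=> v; split=> // _; apply: le_lt_trans muD.
by apply: le_measure; rewrite ?inE.
Qed.

End bochner_integral_theory.

(** * The forward-backward-forward step *)

Section forward_backward_step.
Context {R : realType} {H : completeNormedModType R}.
Variables (dot : {dot H for idfun}) (dotE : forall u : H, dot u u = `|u| ^+ 2).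
Variables (f : H -> \bar R) (h : H -> R) (beta : R).
Hypotheses (f_proper : proper_fun f) (f_convex : econvex f)
  (f_lsc : lower_semicontinuous f) (beta_gt0 : 0 < beta)
  (h_convex : convex_function [set: convex_lmodType H] h)
  (h_diff : forall x, differentiable h x)
  (h_lip : (beta^-1).-lipschitz (gradient dot h)).
Local Notation grad := (gradient dot h).

Lemma gradient_dist_le u v : `|grad u - grad v| <= beta^-1 * `|u - v|.
Proof. by have := @h_lip (u, v); apply. Qed.

Lemma gradient_continuous : continuous grad.
Proof.
move=> u; apply/cvgrPdist_lt => _/posnumP[e].
have be : 0 < beta * e%:num by rewrite mulr_gt0.
have := @cvg_id _ (nbhs u); move=> /cvgrPdist_lt/(_ _ be); apply: filterS => v uv.
by apply: le_lt_trans (gradient_dist_le _ _) _; rewrite mulrC ltr_pdivrMr// mulrC.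
Qed.

(** The left side has [f] and [h] at [z] replaced by their tangents at [p] and [q], so it is affine
    in [z]; [b] stands for [f y]. *)
Lemma flow_energy_le (g b l a : R) (x y z p q dx : H) :
  0 < g < beta -> z = prox g f (x - g *: grad x) ->
  dx = z - x + g *: grad x - g *: grad z ->
  (f y <= b%:E)%E -> 0 < l -> p = prox l f q -> f p = a%:E ->
  g * (a + dot (q - p) (z - p) / l + h q + dot (grad q) (z - q) - b - h y) <=
  - dot dx (x - y).
Proof.
move=> /andP[g0 gb] zE dxE fyb l0 pE fpa.
have [c [fzc hz]] := prox_spec dotE (x - g *: grad x) f_proper f_convex f_lsc g0.
rewrite -zE in fzc hz.
have [a' [fpa' hp]] := prox_spec dotE q f_proper f_convex f_lsc l0.
rewrite -pE fpa in fpa' hp; case: fpa' => ?; subst a'.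
have {}hp : a + dot (q - p) (z - p) / l <= c.
  have := hp z c; rewrite fzc lexx => /(_ isT).
  rewrite -(opprB z p) dotNr mulrC -ler_pdivlMr// mulNr; lra.
have hq := convex_gradient_le dotE z h_convex (h_diff q).
have hzy := convex_gradient_le dotE y h_convex (h_diff z).
have {}hz := hz y b fyb.
(* Intermediate bound with [c = f z]: the tangents at [p] and [q] lie below [f z] and [h z], and the
   tangent of [h] at [z] lies below [h y]. *)
apply: (@le_trans _ _ (g * (c - b) + g * dot (grad z) (z - y))).
  have -> : dot (grad z) (z - y) = - dot (grad z) (y - z).
    by rewrite -dotNr opprB.
  rewrite -mulrDr ler_pM2l//; move: hp hq hzy.
  move: (dot (q - p) (z - p) / l) (dot (grad q) _) (dot (grad z) _).
  move: (h z) (h q) (h y) => hz' hq' hy' A B C {hz}; lra.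
apply: (@le_trans _ _ (dot (- dx) (z - y))).
  apply: le_trans (lerD hz (lexx _)) _; rewrite -dotZl -dotDl.
  have E (u v w s : H) : u - v - w + s = - (w - u + v - s).
    by rewrite !opprD !opprK [- w + u]addrC [u - w - v]addrAC.
  by rewrite E -dxE.
(* The part along [x - z] contributes [dot dx (x - z)], at most [(g / beta - 1) |x - z|^2]. Its sign
   is where [g < beta] enters. *)
have -> : z - y = (x - y) - (x - z) by rewrite [RHS]addrC opprB addrA subrK.
rewrite dotDr dotNr dotNl gerDl oppr_le0 dotNl oppr_ge0.
have -> : dx = g *: (grad x - grad z) - (x - z).
  by rewrite dxE scalerBr opprB [RHS]addrC addrA.
rewrite dotDl dotNl dotE dotZl subr_le0.
have [->|xz] := eqVneq x z; first by rewrite !subrr dot0r mulr0 normr0 expr0n.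
have xz0 : 0 < `|x - z| by rewrite normr_gt0 subr_eq0.
apply: (@le_trans _ _ (g * (beta^-1 * `|x - z| * `|x - z|))).
  rewrite ler_pM2l//; apply: le_trans (dot_le dotE _ _) _.
  by rewrite ler_pM2r// gradient_dist_le.
rewrite -mulrA -expr2 mulrA ger_pMl ?exprn_gt0//.
by rewrite ler_pdivrMr// mul1r ltW.
Qed.

Lemma prox_cvg (g_ : nat -> R) (u_ : nat -> H) (m : R) (v : H) :
  (forall n, 0 < g_ n) -> 0 < m -> g_ n @[n --> \oo] --> m ->
  u_ n @[n --> \oo] --> v ->
  prox (g_ n) f (u_ n) @[n --> \oo] --> prox m f v.
Proof.
move=> g0 m0 gm uv; apply/subr_cvg0; apply: norm_cvg0.
apply: (squeeze_cvgr (f := cst 0) (h := fun n => `|u_ n - v| +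
    `|1 - g_ n / m| * `|v - prox m f v|)).
- by apply: nearW => n; rewrite normr_ge0/= (prox_dist_le dotE).
- exact: cvg_cst.
rewrite -[X in _ --> X]addr0; apply: cvgD.
  by rewrite -(normr0 H); apply: cvg_norm; apply/subr_cvg0.
rewrite -(mul0r `|v - prox m f v|); apply: cvgMl.
rewrite -(normr0 R) -(subrr 1); apply: cvg_norm; apply: cvgB; first exact: cvg_cst.
by rewrite -(divff (lt0r_neq0 m0)); apply: cvgMl.
Qed.

(** The reference step size [beta / 2] gives [|1 - g / (beta / 2)| <= 1] for all [g] between 0 and
    [beta], so the bound is uniform in [g]. *)
Lemma prox_norm_le (g : R) u : 0 < g < beta ->
  `|prox g f u| <= `|u| + 2 * `|prox (beta / 2) f 0|.
Proof.
move=> /andP[g0 gb]; have b2 : 0 < beta / 2 by lra.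
have := prox_dist_le dotE u 0 f_proper f_convex f_lsc g0 b2.
set q := prox _ _ 0; rewrite subr0 sub0r normrN => hq.
have : `|1 - g / (beta / 2)| * `|q| <= `|q|.
  rewrite ler_piMl// ler_norml; apply/andP; split.
    by rewrite lerBrDl -lerBrDr opprK ler_pdivrMr//; lra.
  by rewrite gerBl divr_ge0// ltW.
have := ler_normD (prox g f u - q) q; rewrite subrK.
lra.
Qed.

End forward_backward_step.

(** * Completed Lebesgue measure and absolutely continuous curves *)

Lemma ae_le_Rintegral d (T : measurableType d) (R : realType)
    (mu : {measure set T -> \bar R}) (D : set T) (f g : T -> R) :
  measurable D -> mu.-integrable D (EFin \o f) -> mu.-integrable D (EFin \o g) ->
  {ae mu, forall t, D t -> f t <= g t} ->
  \int[mu]_(t in D) f t <= \int[mu]_(t in D) g t.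
Proof.
move=> mD fi gi fg; rewrite -subr_ge0 -RintegralB//.
have i1 := integrableB mD gi fi.
suff -> : \int[mu]_(t in D) (g t - f t) = \int[mu]_(t in D) `|g t - f t|.
  exact: Rintegral_ge0.
congr (fine _); apply: ae_eq_integral => //.
- exact: (measurable_int mu i1).
- exact: (measurable_int mu (integrable_abse i1)).
- by apply: filterS fg => t h Dt /=; rewrite ger0_norm// subr_ge0 h.
Qed.

(** The level sets are preimages of half-open unit intervals. The upper bound on [u] keeps [inord]
    away from its default value. *)
Lemma measurable_grid_level d (T : measurableType d) (R : realType) (D : set T)
    (u : T -> R) N (i : 'I_N.+1) :
  measurable D -> measurable_fun D u -> (forall t, D t -> 0 <= u t < N.+1%:R) ->
  measurable (D `&` (fun t => inord (Num.truncn (u t)) : 'I_N.+1) @^-1` [set i]).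
Proof.
move=> mD mu uN.
rewrite (_ : _ `&` _ = D `&` u @^-1` `[(i : nat)%:R, (i : nat).+1%:R[%classic).
  by apply: mu => //; exact: measurable_itv.
have E t : D t -> (inord (Num.truncn (u t)) == i :> 'I_N.+1) =
    (i%:R <= u t < i.+1%:R).
  move=> /uN/andP[u0 u1].
  by rewrite -truncn_eq// -val_eqE/= inordK// truncn_lt_nat.
apply/seteqP; split=> t [Dt] /=.
  by move=> /eqP; rewrite E// in_itv.
by rewrite in_itv/= -E// => /eqP.
Qed.

Section completed_lebesgue.
Context {R : realType}.
Local Notation mu := (Leb R).
Local Notation LT := (caratheodory_type ((@wlength R idfun)^*)%mu).

Lemma completed_measurable_itv (i : interval R) : measurable ([set` i] : set LT).
Proof. by apply: sub_caratheodory; exact: measurable_itv. Qed.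

Lemma completed_measurable_id (D : set LT) : measurable D ->
  measurable_fun D (fun s : LT => s : R).
Proof.
move=> mD _ B mB; apply: measurableI => //.
by apply: sub_caratheodory; exact: mB.
Qed.

Lemma completed_lebesgue_itv (i : interval R) :
  Leb R [set` i] = lebesgue_measure ([set` i] : set R).
Proof. by []. Qed.

Lemma completed_lebesgue_itv_bnd (a b : bool) (s t : R) : s <= t ->
  Leb R [set` Interval (BSide a s) (BSide b t)] = (t - s)%:E.
Proof.
move=> st; rewrite completed_lebesgue_itv lebesgue_measure_itv /= lte_fin.
have [//|ts] := ltP s t.
by rewrite (@le_anti _ _ s t) ?st// subrr.
Qed.

Lemma Rintegral_completed_set1 (g : R -> R) (a : R) :
  \int[mu]_(s in `[a, a]) g s = 0.
Proof.
have a0 : mu `[a, a] = 0 by rewrite completed_lebesgue_itv_bnd// subrr.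
have ma : measurable (`[a, a]%classic : set LT) by exact: completed_measurable_itv.
have mg : measurable_fun (`[a, a]%classic : set LT) (EFin \o g).
  (* By completeness every function is measurable on a null set. *)
  apply/measurable_EFinP => _ B _; apply: completed_lebesgue_measure_is_complete.
  by exists `[a, a]%classic; split.
by rewrite /Rintegral (null_set_integral ma mg a0).
Qed.

Lemma Rintegral_completed_split (g : R -> R) (a b : R) : 0 <= a <= b ->
  mu.-integrable (`[0, b] : set LT) (EFin \o g) ->
  \int[mu]_(s in `[0, b]) g s =
    \int[mu]_(s in `[0, a]) g s + \int[mu]_(s in `]a, b]) g s.
Proof.
move=> /andP[a0 ab] gi.
have E : `[0, b]%classic = `[0, a] `|` `]a, b] :> set R.
  by rewrite -itv_bndbnd_setU// bnd_simp.
rewrite {1}E Rintegral_setU//.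
- exact: completed_measurable_itv.
- exact: completed_measurable_itv.
- by rewrite -E.
- rewrite disj_set2E; apply/eqP/seteqP; split => // s [] /=.
  by rewrite !in_itv/= => /andP[_ sa] /andP[/lt_geF]; rewrite sa.
Qed.

End completed_lebesgue.

Section absolutely_continuous_curve.
Context {R : realType} {H : completeNormedModType R}.
Variables (dot : {dot H for idfun}) (dotE : forall u : H, dot u u = `|u| ^+ 2).
Variables (x dx : R -> H) (x_ac : loc_abs_cont_derivative x dx).
Local Notation mu := (Leb R).
Local Notation LT := (caratheodory_type ((@wlength R idfun)^*)%mu).

Lemma curve_dot_integrable w (b : R) : 0 < b ->
  mu.-integrable (`[0, b]%classic : set LT) (EFin \o (fun s => dot w (dx s))).
Proof.
move=> b0; have [bi _] := x_ac b0.
by have [] := dot_bochner_integral dotE completed_lebesgue_measure_is_complete w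
  (completed_measurable_itv _) bi.
Qed.

Lemma curve_norm_integrable (b : R) : 0 < b ->
  mu.-integrable (`[0, b]%classic : set LT) (EFin \o (fun s => `|dx s|)).
Proof.
move=> b0; have [bi _] := x_ac b0.
exact: (bochner_norm_integrable completed_lebesgue_measure_is_complete
  (completed_measurable_itv _) bi).
Qed.

Lemma curve_dotE w (b : R) : 0 <= b ->
  dot w (x b - x 0) = \int[mu]_(s in `[0, b]) dot w (dx s).
Proof.
rewrite le_eqVlt => /predU1P[<-|b0].
  by rewrite subrr dot0r Rintegral_completed_set1.
have [bi xE] := x_ac b0.
have [_ <-] := dot_bochner_integral dotE completed_lebesgue_measure_is_complete w
  (completed_measurable_itv _) bi.
by rewrite (xE b) ?lexx ?ltW// addrAC subrr add0r.
Qed.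

Lemma curve_dot_incr w (a b : R) : 0 <= a <= b -> 0 < b ->
  dot w (x b - x a) = \int[mu]_(s in `]a, b]) dot w (dx s).
Proof.
move=> /[dup] ab /andP[a0 _] b0.
rewrite -[RHS](addKr (\int[mu]_(s in `[0, a]) dot w (dx s))).
rewrite -Rintegral_completed_split//; last exact: curve_dot_integrable.
rewrite -!curve_dotE//; last exact: ltW.
by rewrite [RHS]addrC -dotNr -dotDr opprB subrKA.
Qed.

(** The increment of [x] is tested against itself, followed by Cauchy-Schwarz under the integral. *)
Lemma curve_dist_le (a b : R) : 0 <= a <= b -> 0 < b ->
  `|x b - x a| <= \int[mu]_(s in `]a, b]) `|dx s|.
Proof.
move=> ab b0; set v := x b - x a.
have [->|v0] := eqVneq v 0; first by rewrite normr0 Rintegral_ge0.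
have pv : 0 < `|v| by rewrite normr_gt0.
have sub : `]a, b]%classic `<=` `[0, b]%classic.
  move=> s /=; rewrite !in_itv/= => /andP[as' ->]; rewrite andbT.
  by case/andP: ab => a0 _; rewrite (le_trans a0)// ltW.
have m0 : measurable (`[0, b]%classic : set LT) by exact: completed_measurable_itv.
have m1 : measurable (`]a, b]%classic : set LT) by exact: completed_measurable_itv.
have i1 := integrableS m0 m1 sub (curve_dot_integrable v b0).
have i2 := integrableS m0 m1 sub (curve_norm_integrable b0).
rewrite -(ler_pM2l pv) -expr2 -dotE curve_dot_incr// -RintegralZl//.
apply: le_Rintegral => //; first exact: (integrableZl m1 `|v| i2).
by move=> s _; exact: dot_le.
Qed.

(** Absolute continuity of the integral of [|dx|], extended by 0 outside the interval. *)
Lemma curve_uniformly_continuous (t e : R) : 0 < t -> 0 < e ->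
  exists2 delta : R, 0 < delta &
    forall a b, 0 <= a <= b -> b <= t -> b - a < delta -> `|x b - x a| <= e.
Proof.
move=> t0 e0.
have m0 : measurable (`[0, t]%classic : set LT) by exact: completed_measurable_itv.
pose g : LT -> R := (fun s => `|dx s|) \_ `[0, t]%classic.
have gi : mu.-integrable setT (EFin \o g).
  rewrite /g -restrict_EFin; apply/(integrable_mkcond _ m0).
  exact: curve_norm_integrable.
have [delta [delta0 hdelta]] := integral_normr_continuous gi e0.
exists delta => // a b /[dup] ab0 /andP[a0 ab] bt abd.
have [->|ba] := eqVneq b a; first by rewrite subrr normr0 ltW.
have b0 : 0 < b by rewrite (le_lt_trans a0)// lt_neqAle eq_sym ba.
apply: le_trans (curve_dist_le ab0 b0) _.
have m1 : measurable (`]a, b]%classic : set LT) by exact: completed_measurable_itv.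
have mabd : (mu `]a, b]%classic < delta%:E)%E.
  by rewrite completed_lebesgue_itv_bnd// lte_fin.
apply: le_trans (ltW (hdelta _ m1 mabd)); rewrite le_eqVlt; apply/orP; left; apply/eqP.
apply: eq_Rintegral => s; rewrite inE /= in_itv/= => /andP[as' sb].
rewrite /g patchT ?normr_id// inE /= in_itv/= (le_trans sb bt) andbT.
by rewrite (le_trans a0)// ltW.
Qed.

End absolutely_continuous_curve.

(** * The flow *)

Section grid.
Context {R : realType}.

Definition grid (n : nat) (v : R) : R := (Num.truncn (n.+1%:R * v))%:R / n.+1%:R.

Lemma grid_ge0 n v : 0 <= grid n v.
Proof. by rewrite divr_ge0. Qed.

Lemma grid_le n v : 0 <= v -> grid n v <= v.
Proof.
by move=> v0; rewrite ler_pdivrMr// mulrC truncn_le mulr_ge0.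
Qed.

Lemma grid_gt n v : v < grid n v + n.+1%:R^-1.
Proof.
rewrite -[n.+1%:R^-1]mul1r -mulrDl ltr_pdivlMr// mulrC natr1.
exact: truncnS_gt.
Qed.

Lemma grid_succ_le1 n v : 0 <= v < 1 -> grid n v + n.+1%:R^-1 <= 1.
Proof.
move=> /andP[v0 v1]; rewrite -[n.+1%:R^-1]mul1r -mulrDl ler_pdivrMr// mul1r.
by rewrite natr1 ler_nat truncn_lt_nat ?mulr_ge0// gtr_pMr.
Qed.

Lemma grid_cvg v : 0 <= v -> grid n v @[n --> \oo] --> v.
Proof.
move=> v0; apply: (squeeze_cvgr (f := fun n => v - n.+1%:R^-1) (h := cst v)).
- by apply: nearW => n; rewrite /= grid_le// andbT lerBlDr ltW// grid_gt.
- rewrite -[X in _ --> X]subr0; apply: cvgB; [exact: cvg_cst|exact: cvg_harmonic].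
- exact: cvg_cst.
Qed.

End grid.

(** * Positivity of [Gamma] and Bochner integrability of [gamma z] *)

Section flow.
Context {R : realType} {H : completeNormedModType R}.
Variables (dot : {dot H for idfun}) (dotE : forall u : H, dot u u = `|u| ^+ 2).
Variables (f : H -> \bar R) (h : H -> R) (beta : R).
Hypotheses (f_proper : proper_fun f) (f_convex : econvex f)
  (f_lsc : lower_semicontinuous f) (beta_gt0 : 0 < beta)
  (h_lip : (beta^-1).-lipschitz (gradient dot h)).
Variables (x dx : R -> H) (x_ac : loc_abs_cont_derivative x dx).
Variables (gamma : R -> R) (gamma_meas : lebesgue_measurable_fun `[0, +oo[ gamma)
  (gamma_bnd : forall s, 0 <= s -> 0 < gamma s < beta).
Local Notation mu := (Leb R).
Local Notation LT := (caratheodory_type ((@wlength R idfun)^*)%mu).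
Local Notation grad := (gradient dot h).

Lemma curve_bounded (t : R) : 0 < t ->
  exists X, forall s, 0 <= s <= t -> `|x s| <= X.
Proof.
move=> t0; exists (`|x 0| + \int[mu]_(s in `[0, t]) `|dx s|) => s /andP[s0 st].
have -> : x s = x 0 + (x s - x 0) by rewrite addrC subrK.
apply: le_trans (ler_normD _ _) _; rewrite lerD2l.
move: s0; rewrite le_eqVlt => /predU1P[<-|s0].
  by rewrite subrr normr0 Rintegral_ge0.
have ss : 0 <= (0 : R) <= s by rewrite lexx ltW.
apply: le_trans (curve_dist_le dotE x_ac ss s0) _.
have it := curve_norm_integrable x_ac t0.
have is_ := curve_norm_integrable x_ac s0.
rewrite (@Rintegral_completed_split _ _ s t) ?(ltW s0)//.
rewrite (@Rintegral_completed_split _ _ 0 s)// Rintegral_completed_set1 add0r.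
by rewrite lerDl Rintegral_ge0.
Qed.

Lemma measurable_gamma (t : R) :
  measurable_fun (`[0, t]%classic : set LT) gamma.
Proof.
apply: (measurable_funS _ _ gamma_meas); first exact: completed_measurable_itv.
by move=> s /=; rewrite !in_itv/= => /andP[->].
Qed.

Lemma integrable_gamma (t : R) : 0 < t ->
  mu.-integrable (`[0, t]%classic : set LT) (EFin \o gamma).
Proof.
move=> t0.
have m0 : measurable (`[0, t]%classic : set LT) by exact: completed_measurable_itv.
have ib : mu.-integrable (`[0, t]%classic : set LT) (EFin \o cst beta).
  apply/integrableP; split; first by apply/measurable_EFinP; exact: measurable_cst.
  by rewrite /= integral_cst//= completed_lebesgue_itv_bnd ?(ltW t0)// -EFinM ltry.
apply: (le_integrable m0 _ _ ib).
  by apply/measurable_EFinP; exact: measurable_gamma.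
move=> s /=; rewrite in_itv/= => /andP[/gamma_bnd/andP[g0 gb] _].
by rewrite lee_fin !ger0_norm ?ltW.
Qed.

(** A zero integral would force [gamma = 0] almost everywhere on an interval of length [t], where
    [gamma] is positive. *)
Lemma Gamma_gt0 (t : R) : 0 < t -> 0 < Gamma gamma t.
Proof.
move=> t0; have gi := integrable_gamma t0.
have m0 : measurable (`[0, t]%classic : set LT) by exact: completed_measurable_itv.
have gp s : `[0, t]%classic s -> 0 < gamma s.
  by rewrite /= in_itv/= => /andP[/gamma_bnd/andP[]].
have G0 : 0 <= Gamma gamma t by apply: Rintegral_ge0 => s /gp/ltW.
rewrite lt_neqAle G0 andbT; apply/eqP => /esym G00.
pose D : set LT := `[0, t]%classic.
have I0 : (\int[mu]_(s in D) `|(EFin \o gamma) s| = 0)%E.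
  transitivity (\int[mu]_(s in D) (EFin \o gamma) s)%E.
    by apply: eq_integral => s; rewrite inE => /gp/ltW gs /=; rewrite ger0_norm.
  by rewrite -[LHS]fineK; [congr EFin|exact: integrable_fin_num].
have [N [mN N0 hN]] : ae_eq mu D (EFin \o gamma) (cst 0%E).
  by apply/ae_eq_integral_abs => //; exact: measurable_int gi.
have : (mu D <= mu N)%E.
  apply: le_measure; rewrite ?inE// => s st; apply: hN => /= /(_ st) [].
  by apply/eqP; rewrite gt_eqF// gp.
by rewrite N0 /D completed_lebesgue_itv_bnd ?(ltW t0)// lee_fin subr0 leNgt t0.
Qed.

Lemma flow_bochner_integrable (t : R) (z : R -> H) : 0 < t ->
  (forall s, 0 <= s -> z s = prox (gamma s) f (x s - gamma s *: grad (x s))) ->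
  bochner_integrable mu (`[0, t]%classic : set LT) (fun s => gamma s *: z s).
Proof.
move=> t0 zE.
have m0 : measurable (`[0, t]%classic : set LT) by exact: completed_measurable_itv.
pose D : set LT := `[0, t]%classic.
have mut : (mu D < +oo)%E.
  by rewrite /D completed_lebesgue_itv_bnd ?(ltW t0)// ltry.
(* Midpoints of the cells, not left endpoints: the approximate step sizes must stay strictly between
   0 and [beta]. *)
pose G n (i : nat) : R := beta * ((i%:R + 2^-1) / n.+1%:R).
pose P n (p : 'I_n.+1 * 'I_n.+2) : H := let u := x (t * (p.2%:R / n.+1%:R)) in
  G n p.1 *: prox (G n p.1) f (u - G n p.1 *: grad u).
(* [gamma s / beta < 1] needs [n + 1] indices; [s / t] reaches 1 at [s = t], which takes one
   more. *)
pose c n (s : LT) : 'I_n.+1 * 'I_n.+2 :=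
  (inord (Num.truncn (n.+1%:R * (gamma s / beta))),
   inord (Num.truncn (n.+1%:R * (s / t)))).
pose g n (s : R) := beta * (grid n (gamma s / beta) + 2^-1 / n.+1%:R).
pose u n (s : R) := x (t * grid n (s / t)).
have g01 s : 0 <= s -> 0 <= gamma s / beta < 1.
  move=> /gamma_bnd/andP[g0 gb].
  by rewrite divr_ge0 ?ltW//= ltr_pdivrMr// mul1r.
have s01 s : 0 <= s <= t -> 0 <= s / t <= 1.
  by move=> /andP[s0 st]; rewrite divr_ge0 ?(ltW t0)//= ler_pdivrMr// mul1r.
have gb n s : 0 <= s -> 0 < g n s < beta.
  move=> /g01 gs; have n0 : 0 < n.+1%:R^-1 :> R by rewrite invr_gt0.
  have g1 := grid_succ_le1 n gs; have g0 := grid_ge0 n (gamma s / beta).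
  move: n0 g1 g0; rewrite /g; move: (grid _ _) n.+1%:R^-1 => v e n0 g1 g0.
  have e2 : 2^-1 * e < e by lra.
  by rewrite gtr_pMr// mulr_gt0//=; lra.
have ut n s : 0 <= s <= t -> 0 <= t * grid n (s / t) <= s.
  move=> /s01/andP[s0 _]; rewrite mulr_ge0 ?grid_ge0 ?(ltW t0)//=.
  by rewrite mulrC -ler_pdivlMr// grid_le.
have cE n s : 0 <= s <= t ->
    P n (c n s) = g n s *: prox (g n s) f (u n s - g n s *: grad (u n s)).
  move=> /[dup] /s01/andP[s0 s1] /andP[ss _]; have /andP[g0 g1] := g01 _ ss.
  have k1 : (Num.truncn (n.+1%:R * (gamma s / beta))%R < n.+1)%N.
    by rewrite truncn_lt_nat ?gtr_pMr//; apply: mulr_ge0.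
  have k2 : (Num.truncn (n.+1%:R * (s / t))%R < n.+2)%N.
    rewrite truncn_lt_nat; last by apply: mulr_ge0.
    apply: (@le_lt_trans _ _ n.+1%:R).
      by rewrite ler_piMr.
    by rewrite ltr_nat.
  by rewrite /P /c /= !inordK// /g /u /grid /G mulrDl.
have [X hX] := curve_bounded t0.
pose Q := `|prox (beta / 2) f 0|.
(* [C] combines [g n s < beta], the bound [X] on the curve, the Lipschitz bound on the gradient
   relative to 0, and [prox_norm_le]. *)
apply: (bochner_integrable_bounded_limit (s_ := fun n => P n \o c n)
  (C := beta * (X + beta * (`|grad 0| + beta^-1 * X) + 2 * Q))) => //.
- move=> n; apply: integrable_simple_fin => // -[i j].
  have mg : measurable_fun D (fun s => n.+1%:R * (gamma s / beta)).
    apply: measurable_funM; first exact: measurable_cst.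
    by apply: measurable_funM; [exact: measurable_gamma|exact: measurable_cst].
  have ms : measurable_fun D (fun s => n.+1%:R * (s / t)).
    apply: measurable_funM; first exact: measurable_cst.
    by apply: measurable_funM; [exact: completed_measurable_id|exact: measurable_cst].
  have bg s : D s -> 0 <= n.+1%:R * (gamma s / beta) < n.+1%:R.
    rewrite /D/= in_itv/= => /andP[/g01/andP[v0 v1] _].
    by rewrite mulr_ge0//= gtr_pMr.
  have bs s : D s -> 0 <= n.+1%:R * (s / t) < n.+2%:R.
    rewrite /D/= in_itv/= => /s01/andP[v0 v1]; rewrite mulr_ge0//=.
    by rewrite (@le_lt_trans _ _ n.+1%:R)// ?ler_piMr// ltr_nat.
  rewrite (_ : _ `&` _ =
      (D `&` (fun s => inord (Num.truncn (n.+1%:R * (gamma s / beta)))) @^-1` [set i])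
      `&` (D `&` (fun s => inord (Num.truncn (n.+1%:R * (s / t)))) @^-1` [set j])).
    by apply: measurableI; [exact: (measurable_grid_level i m0 mg bg)
                          |exact: (measurable_grid_level j m0 ms bs)].
  apply/seteqP; split=> s [Ds].
    by move=> [e1 e2]; split.
  by move: Ds => [Ds e1] [_ e2]; split=> //; congr pair.
- move=> s /=; rewrite in_itv/= => st; have /andP[s0 _] := st.
  rewrite zE//; under eq_fun do rewrite cE//.
  have gcvg : g n s @[n --> \oo] --> gamma s.
    rewrite -[X in _ --> X](divfK (lt0r_neq0 beta_gt0)) [X in _ --> X]mulrC.
    apply: cvgMr; rewrite -[X in _ --> X]addr0; apply: cvgD.
      by apply: grid_cvg; case/andP: (g01 _ s0).
    rewrite -[X in _ --> X](mulr0 2^-1); apply: cvgMr; exact: cvg_harmonic.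
  have ucvg : u n s @[n --> \oo] --> x s.
    apply/cvgrPdist_le => e e0.
    have [delta delta0 hd] := curve_uniformly_continuous dotE x_ac t0 e0.
    have tcvg : t * grid n (s / t) @[n --> \oo] --> s.
      rewrite -[X in _ --> X](divfK (lt0r_neq0 t0)) [X in _ --> X]mulrC.
      by apply: cvgMr; apply: grid_cvg; case/andP: (s01 _ st).
    have /cvgrPdist_lt/(_ _ delta0) := tcvg; apply: filterS => n.
    move=> /(le_lt_trans (ler_norm _)); apply: hd; last by case/andP: st.
    exact: ut.
  apply: cvgZ => //; apply: (prox_cvg dotE) => //.
  - by move=> n; case/andP: (gb n _ s0).
  - by case/andP: (gamma_bnd s0).
  - apply: cvgB => //; apply: cvgZ => //.
    exact: (cvg_comp _ grad ucvg (@gradient_continuous _ _ _ _ _ beta_gt0 h_lip _)).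
- move=> n s /=; rewrite in_itv/= => st; have /andP[s0 s1] := st.
  rewrite cE// normrZ; have /andP[g0 g1] := gb n _ s0.
  rewrite gtr0_norm//; apply: ler_pM => //; [exact: ltW|exact: ltW|].
  have hu : `|u n s| <= X.
    by apply: hX; have /andP[-> us] := ut n _ st; rewrite (le_trans us).
  have gu : `|grad (u n s)| <= `|grad 0| + beta^-1 * X.
    rewrite -[grad (u n s)](subrK (grad 0)) addrC.
    apply: le_trans (ler_normD _ _) _; rewrite lerD2l.
    apply: le_trans (gradient_dist_le h_lip _ _) _.
    by rewrite subr0 ler_pM2l// invr_gt0.
  apply: le_trans (prox_norm_le dotE f_proper f_convex f_lsc _ (gb n _ s0)) _.
  rewrite lerD2r; apply: le_trans (ler_normB _ _) _; apply: lerD => //.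
  by rewrite normrZ gtr0_norm//; apply: ler_pM => //; exact: ltW.
Qed.

End flow.

(** * The integrated energy inequality and the conclusion *)

Lemma le_addgt0_mulr (R : realFieldType) (a b c : R) : 0 <= c ->
  (forall e, 0 < e -> a <= b + e * c) -> a <= b.
Proof.
move=> c0 ab; apply/ler_addgt0Pr => e e0.
have c1 : 0 < c + 1 by rewrite ltr_wpDl.
apply: le_trans (ab (e / (c + 1)) (divr_gt0 e0 c1)) _.
by rewrite lerD2l mulrAC ler_pdivrMr// ler_wpM2l ?(ltW e0)// lerDl.
Qed.

Lemma curve_energy_le (R : realType) (H : completeNormedModType R)
    (dot : {dot H for idfun}) (dotE : forall u : H, dot u u = `|u| ^+ 2)
    (x dx : R -> H) (x_ac : loc_abs_cont_derivative x dx)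
    (L : R -> R) (y : H) (t : R) : 0 < t ->
  (Leb R).-integrable `[0, t]%classic (EFin \o L) ->
  {ae (Leb R), forall s, 0 <= s -> L s <= - dot (dx s) (x s - y)} ->
  \int[Leb R]_(s in `[0, t]) L s <= `|x 0 - y| ^+ 2 / 2.
Proof.
set LT := caratheodory_type _; move=> t0 iL Lle.
pose I (g : R -> R) s := \int[Leb R]_(r in (`[0, s]%classic : set LT)) g r.
have ndx := curve_norm_integrable x_ac t0.
have m_itv (i : interval R) : measurable ([set` i] : set LT).
  exact: completed_measurable_itv.
have iS (g : R -> R) (i : interval R) : [set` i] `<=` `[0, t]%classic ->
    (Leb R).-integrable (`[0, t]%classic : set LT) (EFin \o g) ->
    (Leb R).-integrable ([set` i] : set LT) (EFin \o g).
  by move=> it; apply: integrableS.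
apply: (@le_addgt0_mulr _ _ _ (I (fun s => `|dx s|) t)).
  by apply: Rintegral_ge0.
move=> e e0; have [delta delta0 hd] := curve_uniformly_continuous dotE x_ac t0 e0.
pose V s := `|x s - y| ^+ 2 / 2.
(* The energy inequality on [[0, s]] up to an error that is additive over subintervals, so that it
   propagates along a subdivision. *)
pose P s := I L s <= V 0 - V s + e * I (fun s => `|dx s|) s.
suff : P t.
  move=> /le_trans; apply; rewrite lerD2r gerBl.
  by rewrite divr_ge0 ?sqr_ge0.
have step a b : 0 <= a <= b -> b <= t -> b - a < delta -> P a -> P b.
  move=> /[dup] ab0 /andP[a0 ab] bt abd Pa.
  have [->//|ba] := eqVneq b a.
  have b0 : 0 < b by rewrite (le_lt_trans a0)// lt_neqAle eq_sym ba.
  have sb : `[0, b]%classic `<=` `[0, t]%classic.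
    by move=> s /=; rewrite !in_itv/= => /andP[->] /le_trans ->.
  have sab : `]a, b]%classic `<=` `[0, t]%classic.
    move=> s /=; rewrite !in_itv/= => /andP[as' /le_trans -> //].
    by rewrite andbT (le_trans a0)// ltW.
  have iab := iS (fun s => `|dx s|) _ sab ndx.
  have iLab := iS L _ sab iL.
  have idab w : (Leb R).-integrable (`]a, b]%classic : set LT)
      (EFin \o (fun s => dot w (dx s))).
    exact: iS (curve_dot_integrable dotE x_ac w t0).
  rewrite /P /I (Rintegral_completed_split ab0 (iS _ _ sb iL)).
  rewrite (Rintegral_completed_split ab0 (iS _ _ sb ndx)).
  (* The right endpoint makes the discarded term |x b - x a|^2 / 2 favourable. *)
  pose w := y - x b.
  have hL : \int[Leb R]_(s in (`]a, b]%classic : set LT)) L s <=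
      dot w (x b - x a) +
      e * \int[Leb R]_(s in (`]a, b]%classic : set LT)) `|dx s|.
    rewrite (curve_dot_incr dotE x_ac w ab0 b0) -RintegralZl// -RintegralD//; last first.
      exact: (integrableZl (m_itv _) e iab).
    apply: ae_le_Rintegral => //.
      exact: (integrableD (m_itv _) (idab w) (integrableZl (m_itv _) e iab)).
    case: Lle => N [mN N0 LN]; exists N; split => // s /= nle; apply: LN => /= Ls.
    apply: nle; rewrite in_itv/= => /andP[as' sb'].
    have s0 : 0 <= s by rewrite (le_trans a0)// ltW.
    apply: le_trans (Ls s0) _; rewrite -lerBlDl.
    (* The cost of freezing [x] at [b]; it is at most [e |dx s|] because the subinterval is shorter
       than [delta]. *)
    have -> : - dot (dx s) (x s - y) - dot w (dx s) = dot (dx s) (x b - x s).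
      rewrite (dotC dot w) /w -opprD -dotDr -dotNr; congr (dot _ _).
      by rewrite addrA subrK opprB.
    apply: le_trans (dot_le dotE _ _) _; rewrite mulrC ler_wpM2r//.
    apply: hd => //; first by rewrite s0.
    by apply: le_lt_trans abd; rewrite lerD2l lerN2 ltW.
  have hV : dot w (x b - x a) <= V a - V b.
    have E : x a - y = - w - (x b - x a) by rewrite /w !opprB [RHS]addrC subrKA.
    rewrite /V E (sqr_normB dotE (- w)) -[x b - y]opprB -/w !normrN dotNl.
    move: (sqr_ge0 `|x b - x a|) (dot w _); move: (`|w| ^+ 2) (`|x b - x a| ^+ 2).
    by move=> W D2 D20 D; lra.
  move: Pa; rewrite /P /I => Pa; rewrite mulrDr.
  apply: le_trans (lerD Pa hL) _; move: hV.
  by move: (V a) (V b) (V 0) (dot w _) => va vb v0 D; lra.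
have [N Nt] : exists N : nat, t / N.+1%:R < delta.
  exists (Num.truncn (t / delta)); rewrite ltr_pdivrMr// mulrC -ltr_pdivrMr//.
  exact: truncnS_gt.
have PN k : (k <= N.+1)%N -> P (t * (k%:R / N.+1%:R)).
  elim: k => [_|k IH kN].
    by rewrite mul0r mulr0 /P /I !Rintegral_completed_set1 subrr add0r mulr0.
  have N0 : 0 < N.+1%:R :> R by rewrite ltr0n.
  apply: step (IH (ltnW kN)).
  - rewrite mulr_ge0 ?(ltW t0) ?divr_ge0//= ler_pM2l// ler_pM2r ?invr_gt0//.
    by rewrite ler_nat.
  - by rewrite ger_pMr// ler_pdivrMr// mul1r ler_nat.
  - by rewrite -mulrBr -mulrBl -natrB// subSnn mul1r.
by have := PN N.+1 (leqnn _); rewrite divff ?mulr1// pnatr_eq0.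
Qed.

Theorem theorem4 (R : realType) (H : completeNormedModType R)
    (dot : {dot H for idfun}) (dotE : forall u : H, dot u u = `|u| ^+ 2)
    (f : H -> \bar R) (h : H -> R) (beta : R)
    (f_proper : proper_fun f) (f_convex : econvex f)
    (f_lsc : lower_semicontinuous f)
    (beta_gt0 : 0 < beta)
    (h_convex : convex_function [set: convex_lmodType H] h)
    (h_diff : forall x, differentiable h x)
    (h_lip : (beta^-1).-lipschitz (gradient dot h))
    (gamma : R -> R)
    (gamma_meas : lebesgue_measurable_fun `[0, +oo[ gamma)
    (gamma_bnd : forall t, 0 <= t -> 0 < gamma t < beta)
    (x0 : H) (x z : R -> H)
    (sol : strong_global_solution dot f h gamma x0 x z) :
  forall (y : H) (t : R), 0 < t -> edom f (zeta gamma z t) ->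
    (f (zeta gamma z t) + (h (zeta gamma z t))%:E <=
     f y + (h y)%:E + (`|x 0 - y| ^+ 2 / (2 * Gamma gamma t))%:E)%E.
Proof.
move=> y t t0 _; case: sol => zE [dx x_ac ode] _.
have fE u : (f u < +oo)%E -> f u = (fine (f u))%:E.
  by move=> fu; rewrite fineK// fin_numE f_proper.1 lt_eqF.
(* Outside the domain of [f] the right-hand side is [+oo]. *)
have [/fE fyE|] := ltP (f y) +oo%E; last first.
  by rewrite leye_eq => /eqP ->; rewrite !addye// leey.
have G0 := Gamma_gt0 beta_gt0 gamma_meas gamma_bnd t0.
have m0 : measurable (`[0, t]%classic :
    set (caratheodory_type ((@wlength R idfun)^*)%mu)).
  exact: completed_measurable_itv.
have bi := flow_bochner_integrable dotE f_proper f_convex f_lsc beta_gt0 h_lip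
  x_ac gamma_meas gamma_bnd t0 zE.
have gi := integrable_gamma beta_gt0 gamma_meas gamma_bnd t0.
have zetaE : bochner_integral (Leb R) `[0, t] (fun s => gamma s *: z s) =
    Gamma gamma t *: zeta gamma z t.
  by rewrite /zeta scalerA divff ?scale1r// gt_eqF.
move: zetaE; set q := zeta gamma z t => zetaE.
pose K := `|x 0 - y| ^+ 2 / (2 * Gamma gamma t).
suff fq : (f q <= (fine (f y) + h y + K - h q)%:E)%E.
  by rewrite fyE -!EFinD -leeBrDr// -EFinB.
apply: (le_of_prox_le dotE f_proper f_convex f_lsc) => l a l0 fpa.
have pE : prox l f q = prox l f q by [].
move: {1}(prox l f q) pE fpa => p pE; rewrite -pE => fpa.
(* [w] and [c] collect the slope and the constant of the tangent lower bound, so that [L s] is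
   [gamma s * (c + dot w (z s))]. *)
pose w := l^-1 *: (q - p) + gradient dot h q.
pose c := a - dot (q - p) p / l + h q - dot (gradient dot h q) q - fine (f y) - h y.
pose L s := c * gamma s + dot w (gamma s *: z s).
have [iw wE] := dot_bochner_integral dotE completed_lebesgue_measure_is_complete w m0 bi.
have iL : (Leb R).-integrable `[0, t]%classic (EFin \o L).
  exact: (integrableD m0 (integrableZl m0 c gi) iw).
have := curve_energy_le dotE x_ac (y := y) t0 iL.
(* Since [gamma z] integrates to [Gamma q], the affine bound is evaluated exactly at the
   barycenter. *)
have -> : \int[Leb R]_(s in `[0, t]) L s = Gamma gamma t * (c + dot w q).
  rewrite RintegralD//; last exact: (integrableZl m0 c gi).
  by rewrite RintegralZl// -wE zetaE dotZr mulrDr mulrC.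
(* At [q] the tangent of [h] equals [h q], and that of [f] equals [f p + |q - p|^2 / l], the
   quantity required by [le_of_prox_le]. *)
have -> : c + dot w q = a + `|q - p| ^+ 2 / l + h q - fine (f y) - h y.
  by rewrite /c /w -dotE !dotL; ring.
move=> /(_ _) energy.
suff : Gamma gamma t * (a + `|q - p| ^+ 2 / l + h q - fine (f y) - h y) <=
    `|x 0 - y| ^+ 2 / 2.
  have KE : K = `|x 0 - y| ^+ 2 / 2 / Gamma gamma t by rewrite /K invfM mulrA.
  by rewrite mulrC -ler_pdivlMr// -KE; lra.
apply: energy; case: ode => N [mN N0 hN]; exists N; split => // s /= Ls.
apply: hN => /= dxE; apply: Ls => s0.
have gb := gamma_bnd s s0.
have {}dxE : dx s = z s - x s + gamma s *: gradient dot h (x s)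
    - gamma s *: gradient dot h (z s).
  apply/eqP; rewrite -subr_eq0; apply/eqP; rewrite [RHS]dxE//.
  by rewrite !opprD !opprK !addrA [dx s - z s + x s]addrAC.
have fyb : (f y <= (fine (f y))%:E)%E by rewrite -fyE.
apply: le_trans (flow_energy_le dotE f_proper f_convex f_lsc beta_gt0 h_convex
  h_diff h_lip gb (zE s s0) dxE fyb l0 pE fpa).
by rewrite /L /c /w !dotL; rewrite le_eqVlt; apply/orP; left; apply/eqP; ring.
Qed.
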